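(* Let $m\geq 1$ and $n\geq 1$ be integers, and let $F_{m,n}=E_m+P_n$ be the generalized fan graph. The complete double vertex graph $M_2(F_{m,n})$ is Hamiltonian if and only if $n\geq 2$ and $1\leq m\leq 2(n-1)$.
   Context: All graphs are simple. For a graph $G$, the complete double vertex graph $M_2(G)$ is the graph whose vertices are all $2$-multisubsets of $V(G)$ (i.e., unordered pairs $\{x,y\}$ with $x,y\in V(G)$, where $x=y$ is allowed), and two such vertices are adjacent if their symmetric difference as multisets is a pair $\{a,b\}$ of vertices with $ab\in E(G)$. For disjoint graphs $G,H$, the join $G+H$ has vertex set $V(G)\cup V(H)$ and edge set $E(G)\cup E(H)\cup\{xy: x\in V(G), y\in V(H)\}$. $E_m$ denotes the edgeless graph on $m$ vertices and $P_n$ the path on $n$ vertices; the generalized fan graph is $F_{m,n}=E_m+P_n$. *)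

(* Defs.v *)
From HB Require Import structures.
From mathcomp Require Import all_boot.
From mathcomp Require Import finmap multiset.

Set Implicit Arguments.
Unset Strict Implicit.
Unset Printing Implicit Defensive.

Local Open Scope mset_scope.

Record sgraph := SGraph {
  vertex :> finType;
  adj : rel vertex;
  adj_sym : symmetric adj;
  adj_irr : irreflexive adj
}.

Definition hamiltonian (G : sgraph) : Prop :=
  exists c : seq G, [/\ 3 <= size c, ucycle (@adj G) c & forall v : G, v \in c].

Section Edgeless.
Variable m : nat.

Definition edgeless_adj : rel 'I_m := fun _ _ => false.

Lemma edgeless_sym : symmetric edgeless_adj. Proof. by []. Qed.

Lemma edgeless_irr : irreflexive edgeless_adj. Proof. by []. Qed.

Definition edgeless_graph : sgraph := SGraph edgeless_sym edgeless_irr.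

End Edgeless.

Section Path.
Variable n : nat.

Definition path_adj : rel 'I_n :=
  fun i j => (i.+1 == j :> nat) || (j.+1 == i :> nat).

Lemma path_sym : symmetric path_adj.
Proof. by move=> i j; rewrite /path_adj orbC. Qed.

Lemma path_irr : irreflexive path_adj.
Proof. by move=> i; rewrite /path_adj orbb gtn_eqF. Qed.

Definition path_graph : sgraph := SGraph path_sym path_irr.

End Path.

Section Join.
Variables G H : sgraph.

Definition join_adj : rel (G + H)%type := fun u v =>
  match u, v with
  | inl x, inl y => adj x y
  | inr x, inr y => adj x y
  | _, _ => true
  end.

Lemma join_sym : symmetric join_adj.
Proof. by move=> [x|x] [y|y] //=; rewrite adj_sym. Qed.

Lemma join_irr : irreflexive join_adj.
Proof. by move=> [x|x] /=; rewrite adj_irr. Qed.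

Definition join_graph : sgraph := SGraph join_sym join_irr.

End Join.

Definition fan_graph (m n : nat) : sgraph :=
  join_graph (edgeless_graph m) (path_graph n).

Definition msymdiff (T : choiceType) (A B : {mset T}) : {mset T} :=
  (A `\` B) `+` (B `\` A).

(* [size A] counts the elements of [A] with multiplicity. *)
Record mset2 (T : choiceType) := MSet2 {
  mset2_val :> {mset T};
  _ : size mset2_val == 2
}.

HB.instance Definition _ (T : choiceType) := [isSub for @mset2_val T].
HB.instance Definition _ (T : choiceType) := [Choice of mset2 T by <:].

Section Mset2Finite.
Variable T : finType.

Definition mset2_code (A : mset2 T) : 2.-tuple T := Tuple (valP A).

Definition mset2_decode (t : 2.-tuple T) : option (mset2 T) :=
  insub (seq_mset t : {mset T}).

Lemma mset2_codeK : pcancel mset2_code mset2_decode.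
Proof. by move=> A; rewrite /mset2_decode /= seq_mset_id valK. Qed.

HB.instance Definition _ := PCanIsCountable mset2_codeK.
HB.instance Definition _ : isFinite (mset2 T) := PCanIsFinite mset2_codeK.

End Mset2Finite.

Section CompleteDoubleVertexGraph.
Variable G : sgraph.

Definition complete_double_adj : rel (mset2 G) := fun A B =>
  [exists a : G, exists b : G, adj a b && (msymdiff A B == [mset a; b])].

Lemma complete_double_sym : symmetric complete_double_adj.
Proof.
by move=> A B; rewrite /complete_double_adj /msymdiff msetDC.
Qed.

Lemma complete_double_irr : irreflexive complete_double_adj.
Proof.
move=> A; apply/negbTE/existsP=> -[a /existsP[b /andP[_ /eqP E]]].
have /msetP/(_ a) := E.
by rewrite /msymdiff !msetE2 subnn !msetnE eqxx.
Qed.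

Definition complete_double_vertex_graph : sgraph :=
  SGraph complete_double_sym complete_double_irr.

End CompleteDoubleVertexGraph.

(* Main.v *)
Require Import Defs.
From mathcomp Require Import all_boot zify finmap multiset.

(** Write [w_i] for the vertices of [E_m] and [p_a] for those of [P_n], and call
    a pair outer when it is some [{w_i, w_j}] and mixed when it is some
    [{p_a, w_i}].

    Necessity. An outer pair is adjacent to mixed pairs only. So along a
    Hamiltonian cycle every outer pair is followed by a mixed pair, and so is
    some pair [{p_a, p_b}]; hence [m (m + 1) / 2 < m n].

    Sufficiency. Arrange the pairs that are not outer in a closed tour: first a
    snake through the rows [{p_a, w_0}, {p_a, p_a}, ..., {p_a, p_n-1}], run
    alternately in the two directions, then the columns
    [{p_0, w_j}, ..., {p_n-1, w_j}]. Each outer pair is inserted right after a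
    mixed pair of its own, its slot. The pairs [{w_j, w_j+1}] bridge consecutive
    columns, and [{w_0, w_0}] fits between two pairs [{p_a, w_0}]. In column
    [j > 0] the slot [{p_a, w_j}], [a < n - 1], may receive any pair containing
    [w_j].
    A pair [{w_i, w_j}] with [0 < i < j] and [d = j - i] goes to column [j],
    [a = d], if [d < n - 1] and to column [i], [a = 2 n - 3 - d], otherwise, as
    in a round robin on the [2 n - 3] players [w_1, ..., w_2n-3]. The slots
    [a = 0] receive [{w_j, w_j}], and the slots [a = 1] left free by the bridges
    receive [{w_0, w_j}]. *)

Set Implicit Arguments.
Unset Strict Implicit.
Unset Printing Implicit Defensive.

Section UnorderedPairs.
Local Open Scope mset_scope.
Variable T : choiceType.
Implicit Types (x y : T) (A B : {mset T}).

Lemma size_msetD A B : size (A `+` B) = size A + size B.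
Proof.
rewrite -size_cat; apply: perm_size; apply/allP => x _.
by rewrite /= count_cat !count_mem_mset msetE2.
Qed.

Lemma msetID A B : A `&` B `+` A `\` B = A.
Proof. by apply/msetP => x; rewrite !msetE2; lia. Qed.

Lemma size_msetID A B : size (A `&` B) + size (A `\` B) = size A.
Proof. by rewrite -size_msetD msetID. Qed.

Lemma size_mset1P A : reflect (exists x, A = [mset x]) (size A == 1).
Proof.
apply: (iffP eqP) => [|[x ->]]; last by rewrite enum_msetn.
case AE: (enum_mset A) => [|x []] // _; exists x.
apply/msetP => y; rewrite -count_mem_mset AE msetnE /= eq_sym addn0.
by case: eqP.
Qed.

Lemma size_mset2 x y : size [mset x; y] == 2.
Proof. by rewrite size_msetD !enum_msetn. Qed.

Definition mpair x y : mset2 T := MSet2 (size_mset2 x y).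

Lemma mpairC x y : mpair x y = mpair y x.
Proof. by apply: val_inj; rewrite /= msetDC. Qed.

Lemma mpairP (A : mset2 T) : exists x y, A = mpair x y.
Proof.
have [A0|[x xA]] := mset_0Vmem A.
  by have := valP A; rewrite /= A0 size_mset0.
have /size_mset1P[y Ay] : size (mset2_val A `\ x) == 1.
  by have := valP A; rewrite /= -{1}(msetB1K xA) size_msetD enum_msetn.
by exists x, y; apply: val_inj; rewrite /= -Ay msetB1K.
Qed.

Lemma mpair_inj x y x' y' : mpair x y = mpair x' y' ->
  (x = x' /\ y = y') \/ (x = y' /\ y = x').
Proof.
have tail_inj z t t' : mpair z t = mpair z t' -> t = t'.
  by move=> /(congr1 val) /(can_inj (msetDKB _)) /msetn_inj; apply.
move=> xyE; have: x \in [mset x'; y'].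
  by rewrite -[[mset x'; y']](congr1 val xyE) mset21.
case/mset2P => xE; rewrite {}xE in xyE *; [left | right]; split=> //.
  exact: tail_inj xyE.
by move: xyE; rewrite (mpairC x') => /tail_inj.
Qed.

End UnorderedPairs.

Section CompleteDoubleVertexGraph.
Local Open Scope mset_scope.
Variable G : sgraph.
Local Notation M2 := (complete_double_vertex_graph G).

Lemma adj_neq (x y : G) : adj x y -> x != y.
Proof. by apply: contraTneq => ->; rewrite adj_irr. Qed.

Lemma complete_double_adjP (A B : M2) :
  reflect (exists x y z : G, [/\ A = mpair x y, B = mpair x z & adj y z])
          (adj A B).
Proof.
apply: (iffP existsP) => [[a /existsP[b /andP[ab /eqP AB]]]|].
  have sAB : size (A `\` B) + size (B `\` A) = 2.
    by rewrite -size_msetD -/(msymdiff A B) AB (eqP (size_mset2 a b)).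
  have sA : size (A `&` B) + size (A `\` B) = 2.
    by rewrite size_msetID (eqP (valP A)).
  have sB : size (A `&` B) + size (B `\` A) = 2.
    by rewrite msetIC size_msetID (eqP (valP B)).
  have /size_mset1P[x Ix] : size (A `&` B) == 1 by lia.
  have /size_mset1P[y Ay] : size (A `\` B) == 1 by lia.
  have /size_mset1P[z Bz] : size (B `\` A) == 1 by lia.
  exists x, y, z; split.
  - by apply: val_inj; rewrite /= -Ix -Ay msetID.
  - by apply: val_inj; rewrite /= -Ix -Bz msetIC msetID.
  have /mpair_inj[[-> ->]|[-> ->]] // : mpair y z = mpair a b.
    by apply: val_inj; rewrite /= -AB /msymdiff Ay Bz.
  by rewrite adj_sym.
case=> x [y [z [-> -> yz]]].
exists y; apply/existsP; exists z; rewrite yz /= /msymdiff !msetBDl.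
have neq_yz := adj_neq yz.
by rewrite !mem_msetD1 // in_mset1 // eq_sym.
Qed.

End CompleteDoubleVertexGraph.

Lemma cycle_enter (T : finType) (c : seq T) (A : {set T}) :
    uniq c -> (forall x, x \in c) -> A != set0 -> A != setT ->
  exists2 x, x \notin A & next c x \in A.
Proof.
move=> uniq_c c_all /set0Pn[a aA]; rewrite -subTset => /subsetPn[b _ bA].
apply/exists_inP; apply: contraT; rewrite negb_exists_in => /forall_inP stayA.
have next_inj : injective (next c) := can_inj (prev_next uniq_c).
have clA : fclosed (next c) (~: A).
  apply: (intro_closed (fconnect_sym next_inj)) => x _ /eqP <-.
  by rewrite !inE; apply: stayA.
have ba : fconnect (next c) b a by rewrite (fconnect_cycle (cycle_next uniq_c)).
by have := closed_connect clA ba; rewrite !inE aA bA.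
Qed.

(* The successor map sends [I] into [S], and so does it send the vertex from
   which the cycle enters [I :|: S]. *)
Lemma hamiltonian_card_ltn (G : sgraph) (I S : {set G}) :
    hamiltonian G -> (forall x y, x \in I -> adj x y -> y \in S) ->
    I != set0 -> I :|: S != setT ->
  #|I| < #|S|.
Proof.
case=> c [_ /andP[cyc_c uniq_c] c_all] adjIS I_neq0 IS_neqT.
have adj_next x : adj x (next c x) by apply: next_cycle.
have IS_neq0 : I :|: S != set0 by rewrite setU_eq0 negb_and I_neq0.
have [u] := cycle_enter uniq_c c_all IS_neq0 IS_neqT.
rewrite !inE => /norP[uI uS] next_u.
have next_uS : next c u \in S.
  case/orP: next_u => // next_uI; case/negP: uS.
  by apply: adjIS next_uI _; rewrite adj_sym.
have := cardsU1 u I; rewrite uI add1n => <-.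
rewrite -(card_imset _ (can_inj (prev_next uniq_c))).
apply/subset_leq_card/subsetP => _ /imsetP[x xuI ->].
by move: xuI; rewrite !inE => /predU1P[->|/adjIS]; last exact.
Qed.

Section CycleInsertion.
Variables (T : eqType) (e : rel T) (slot : T -> T) (s : seq T).
Implicit Types (x y z : T) (r : seq T).

Definition guests x := [seq z <- s | slot z == x].

Definition insert r := flatten [seq x :: guests x | x <- r].

Definition detour : rel T := fun x y => path e x (rcons (guests x) y).

Lemma cycle_insert r : cycle detour r -> cycle e (insert r).
Proof.
suff path_insert t x y : path detour x (rcons t y) ->
    path e x (rcons (guests x ++ insert t) y).
  by case: r => //= x r; apply: path_insert.
elim: t x => [|z t IHt] x /=; first by rewrite cats0 andbT.
move=> /andP[xz zt]; rewrite -[insert _]/(z :: (guests z ++ insert t)).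
by rewrite -cat_rcons rcons_cat cat_path last_rcons IHt // andbT.
Qed.

Lemma perm_insert r :
  uniq r -> perm_eq (insert r) (r ++ [seq z <- s | slot z \in r]).
Proof.
elim: r => [_|x r IHr /andP[xr uniq_r]]; first by rewrite filter_pred0.
rewrite -[insert _]/(x :: (guests x ++ insert r)) perm_cons.
rewrite (perm_catl _ (IHr uniq_r)) perm_catCA perm_cat2l.
set t := [seq z <- s | slot z \in x :: r].
have -> : guests x = [seq z <- t | slot z == x].
  by rewrite -filter_predI; apply: eq_filter => z /=; rewrite inE; case: eqP.
have -> : [seq z <- s | slot z \in r]
    = [seq z <- t | predC (fun z => slot z == x) z].
  rewrite -filter_predI; apply: eq_filter => z /=; rewrite inE.
  by case: eqP => // ->; apply: negbTE.
by rewrite perm_filterC.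
Qed.

Lemma detour_free x y : x \notin map slot s -> detour x y = e x y.
Proof.
move=> x_free; suff no_guest : guests x = [::].
  by rewrite /detour no_guest /= andbT.
apply/eqP; rewrite -[_ == _]negbK -has_filter; apply: contra x_free.
by case/hasP => z zs /eqP <-; apply: map_f.
Qed.

Hypotheses (uniq_s : uniq s) (slot_inj : {in s &, injective slot}).

Lemma guests_slot z : z \in s -> guests (slot z) = [:: z].
Proof.
move=> zs; rewrite -(filter_pred1_uniq uniq_s zs).
by apply: eq_in_filter => y ys; rewrite /= (inj_in_eq slot_inj).
Qed.

Lemma detour_slot z y : z \in s -> detour (slot z) y = e (slot z) z && e z y.
Proof. by move=> zs; rewrite /detour guests_slot //= andbT. Qed.

End CycleInsertion.

Lemma rev_iotaS i l : rev (iota i l.+1) = i + l :: rev (iota i l).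
Proof. by rewrite -addn1 iotaD rev_cat. Qed.

Section IotaPath.
Variables (T : Type) (e : rel T) (f : nat -> T).

Lemma path_map_iota i l :
    (forall j, i <= j < i + l -> e (f j) (f j.+1)) ->
  path e (f i) [seq f j | j <- iota i.+1 l].
Proof.
elim: l i => //= l IHl i ef; rewrite ef ?IHl //; last by lia.
by move=> j ij; apply: ef; lia.
Qed.

Lemma last_map_iota i l : last (f i) [seq f j | j <- iota i.+1 l] = f (i + l).
Proof. by elim: l i => [|l IHl] i /=; rewrite ?addn0 // IHl addnS. Qed.

Lemma path_map_rev_iota i l :
    (forall j, i <= j < i + l -> e (f j.+1) (f j)) ->
  path e (f (i + l)) [seq f j | j <- rev (iota i l)].
Proof.
elim: l => //= l IHl ef; rewrite rev_iotaS /= addnS ef ?IHl //; last by lia.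
by move=> j ij; apply: ef; lia.
Qed.

Lemma last_map_rev_iota i l :
  last (f (i + l)) [seq f j | j <- rev (iota i l)] = f i.
Proof. by elim: l => [|l IHl]; rewrite ?addn0 // rev_iotaS. Qed.

End IotaPath.

Section PairCoding.
Variable e : rel nat.

Definition pair_rel : rel (nat * nat) := fun u v =>
  [|| (u.1 == v.1) && e u.2 v.2, (u.1 == v.2) && e u.2 v.1,
      (u.2 == v.1) && e u.1 v.2 | (u.2 == v.2) && e u.1 v.1].

Variables (G : sgraph) (N : nat) (vertex : nat -> G) (code : G -> nat).
Hypothesis vertexK : {in gtn N, cancel vertex code}.
Hypothesis codeK : cancel code vertex.
Hypothesis code_lt : forall v, code v < N.
Hypothesis adj_vertex :
  {in gtn N &, {homo vertex : x y / e x y >-> adj x y}}.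

Local Notation sorted_pairs := [pred u : nat * nat | u.1 <= u.2 < N].

Definition pair_vertex (u : nat * nat) : complete_double_vertex_graph G :=
  mpair (vertex u.1) (vertex u.2).

Lemma adj_pair_vertex :
  {in sorted_pairs &, {homo pair_vertex : u v / pair_rel u v >-> adj u v}}.
Proof.
move=> [x y] [x' y'] /= /andP[le_xy lt_yN] /andP[le_xy' lt_yN'].
have lt_xN := leq_ltn_trans le_xy lt_yN.
have lt_xN' := leq_ltn_trans le_xy' lt_yN'.
have adj_mpair z t t' : t < N -> t' < N -> e t t' ->
    @adj (complete_double_vertex_graph G)
      (mpair (vertex z) (vertex t)) (mpair (vertex z) (vertex t')).
  move=> lt_t lt_t' /(adj_vertex lt_t lt_t') tt'.
  by apply/complete_double_adjP; exists (vertex z), (vertex t), (vertex t').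
rewrite /pair_vertex /pair_rel /= => /or4P[] /andP[/eqP-> /adj_mpair].
- exact.
- by rewrite [mpair (vertex x') _]mpairC; apply.
- by rewrite [mpair _ (vertex x')]mpairC; apply.
- by rewrite ![mpair _ (vertex y')]mpairC; apply.
Qed.

Lemma pair_vertex_inj : {in sorted_pairs &, injective pair_vertex}.
Proof.
have vertex_inj x y : x < N -> y < N -> vertex x = vertex y -> x = y.
  exact: (can_in_inj vertexK).
move=> [x y] [x' y']; rewrite !inE /= => xy xy' /mpair_inj /=.
by case=> -[/vertex_inj xE /vertex_inj yE]; congr pair; lia.
Qed.

Lemma pair_vertexP A : exists2 u, u \in sorted_pairs & A = pair_vertex u.
Proof.
have [v [w ->]] := mpairP A.
wlog le_vw : v w / code v <= code w => [sorted_case|].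
  by case: (leqP (code v) (code w)) => [/sorted_case|/ltnW/sorted_case];
    last rewrite mpairC.
exists (code v, code w); first by rewrite inE /= le_vw code_lt.
by rewrite /pair_vertex /= !codeK.
Qed.

Lemma hamiltonian_complete_double s :
    1 < N -> uniq s -> cycle pair_rel s -> s =i sorted_pairs ->
  hamiltonian (complete_double_vertex_graph G).
Proof.
move=> N_gt1 uniq_s cycle_s mem_s; exists (map pair_vertex s).
have s_sorted : all sorted_pairs s by apply/allP => u; rewrite mem_s.
split.
- rewrite size_map -[3]/(size [:: (0, 0); (0, 1); (1, 1)]).
  apply: uniq_leq_size => // u; rewrite !inE mem_s inE.
  by case/or3P => /eqP-> //=; lia.
- rewrite /ucycle (homo_cycle_in adj_pair_vertex) //=.
  by rewrite map_inj_in_uniq // => u v; rewrite !mem_s; apply: pair_vertex_inj.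
- by move=> A; have [u u_sorted ->] := pair_vertexP A; rewrite map_f ?mem_s.
Qed.

End PairCoding.

Section FanCoding.
Variables (m n : nat) (i0 : 'I_m) (a0 : 'I_n).

Definition fan_vertex x : fan_graph m n :=
  if x < n then inr (insubd a0 x) else inl (insubd i0 (x - n)).

Definition fan_code (v : fan_graph m n) : nat :=
  match v with inl i => n + i | inr a => a end.

Lemma fan_vertexK : {in gtn (n + m), cancel fan_vertex fan_code}.
Proof.
move=> x; rewrite inE /fan_vertex /= => lt_x.
by case: ltnP => lt_xn /=; rewrite val_insubd; case: ifP; lia.
Qed.

Lemma fan_codeK : cancel fan_code fan_vertex.
Proof.
case=> [i|a]; rewrite /fan_vertex /=.
  by rewrite ltnNge leq_addr addKn valKd.
by rewrite ltn_ord valKd.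
Qed.

Lemma fan_code_lt v : fan_code v < n + m.
Proof. by case: v => i /=; have := ltn_ord i; lia. Qed.

Definition fan_rel : rel nat := fun x y =>
  [|| (x < n) && (n <= y), (y < n) && (n <= x)
    | [&& x < n, y < n & (x.+1 == y) || (y.+1 == x)]].

Lemma adj_fan_code u v : adj u v = fan_rel (fan_code u) (fan_code v).
Proof.
rewrite /fan_rel; case: u v => [i|a] [j|b] /=.
- by rewrite /edgeless_adj; lia.
- by have := ltn_ord b; lia.
- by have := ltn_ord a; lia.
- by rewrite /path_adj !ltn_ord /=; have := ltn_ord a; have := ltn_ord b; lia.
Qed.

Lemma adj_fan_vertex :
  {in gtn (n + m) &, {homo fan_vertex : x y / fan_rel x y >-> adj x y}}.
Proof. by move=> x y lt_x lt_y; rewrite adj_fan_code !fan_vertexK. Qed.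

End FanCoding.

Section FanCycle.
Variables m n : nat.
Local Notation edge := (pair_rel (fan_rel n)).

Definition row a := [seq (a, b) | b <- n :: iota a (n - a)].

Definition sweep a := if odd (n + a) then row a else rev (row a).

Fixpoint snake k := if k is k'.+1 then sweep k' ++ snake k' else [::].

Definition columns c l := [seq (a, x) | x <- iota c.+1 l, a <- iota 0 n].

Definition tour :=
  (n.-1, n.-1) :: snake n.-1 ++ (n.-1, n) :: columns n m.-1.

Definition outer_codes := [seq (x, y) | x <- iota n m, y <- iota x (n + m - x)].

(* The parity keeps [(n, n)] off the slots inside the rows swept forwards. *)
Definition slot (u : nat * nat) : nat * nat :=
  let d := u.2 - u.1 in
  if d == 0 then ((u.1 == n) && odd n : nat, u.1)
  else if d == 1 then (n.-1, u.1)
  else if u.1 == n then (1, u.2)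
  else if d < n.-1 then (d, u.2)
  else (2 * n - 3 - d, u.1).

Definition fan_cycle := insert slot outer_codes tour.

Lemma mem_sweep a x y :
  a <= n -> ((x, y) \in sweep a) = (x == a) && (a <= y <= n).
Proof.
move=> le_an; rewrite /sweep (fun_if (fun s => _ \in s)) mem_rev if_same.
apply/mapP/andP => [[b + [-> ->]]|[/eqP-> ay]].
  by rewrite inE mem_iota; split; lia.
by exists y; rewrite // inE mem_iota; lia.
Qed.

Lemma uniq_sweep a : uniq (sweep a).
Proof.
rewrite /sweep (fun_if uniq) rev_uniq if_same.
by rewrite map_inj_uniq => [|b b' [] //]; rewrite /= iota_uniq mem_iota; lia.
Qed.

Lemma mem_snake k x y :
  k <= n -> ((x, y) \in snake k) = (x < k) && (x <= y <= n).
Proof.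
elim: k => [|k IHk] lt_kn //=; have le_kn := ltnW lt_kn.
by rewrite mem_cat IHk // mem_sweep //; lia.
Qed.

Lemma uniq_snake k : k <= n -> uniq (snake k).
Proof.
elim: k => [|k IHk] lt_kn //=; have le_kn := ltnW lt_kn.
rewrite cat_uniq uniq_sweep IHk // andbT.
by apply/hasPn => -[x y]; rewrite /= mem_snake // mem_sweep //; lia.
Qed.

Lemma mem_columns c l x y :
  ((x, y) \in columns c l) = (x < n) && (c < y <= c + l).
Proof.
apply/allpairsP/andP => [[[b a] /= [+ + [-> ->]]]|[xn ym]].
  by rewrite !mem_iota; split; lia.
by exists (y, x); split; rewrite //= mem_iota; lia.
Qed.

Lemma uniq_columns c l : uniq (columns c l).
Proof.
by apply: allpairs_uniq; rewrite ?iota_uniq // => -[b a] [b' a'] _ _ [-> ->].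
Qed.

Lemma mem_outer_codes x y :
  ((x, y) \in outer_codes) = [&& n <= x, x <= y & y < n + m].
Proof.
apply/allpairsPdep/and3P => [[a [b [+ + [-> ->]]]]|[nx xy ym]].
  by rewrite !mem_iota; split; lia.
by exists x, y; rewrite !mem_iota; split=> //; lia.
Qed.

Lemma uniq_outer_codes : uniq outer_codes.
Proof.
apply: allpairs_uniq_dep => [|x _|]; rewrite ?iota_uniq //.
by move=> [x y] [x' y'] _ _ [/= -> ->].
Qed.

Lemma snd_slot z : (slot z).2 = z.1 \/ (slot z).2 = z.2.
Proof.
by rewrite /slot; repeat case: ifP => _; [left|left|right|right|left].
Qed.

Lemma edge_slot a z : z \in outer_codes -> a < n ->
  edge (a, (slot z).2) z && edge z (a, (slot z).2).
Proof.
case: z => x y; rewrite mem_outer_codes => xy lt_an.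
by case: (snd_slot (x, y)) => ->; rewrite /pair_rel /fan_rel /=; lia.
Qed.

Hypotheses (n_gt1 : 1 < n) (m_gt0 : 0 < m) (le_mn : m <= 2 * (n - 1)).

Lemma mem_tour x y : ((x, y) \in tour) = (x < n) && (x <= y < n + m).
Proof.
rewrite in_cons mem_cat mem_snake ?leq_pred // in_cons mem_columns !xpair_eqE.
lia.
Qed.

Lemma uniq_tour : uniq tour.
Proof.
have le_n1 := leq_pred n.
rewrite /= cat_uniq /= mem_cat in_cons negb_or uniq_snake // uniq_columns.
have -> : has [in snake n.-1] (columns n m.-1) = false.
  by apply/hasPn => -[x y]; rewrite mem_columns /= mem_snake //; lia.
rewrite !mem_columns !mem_snake // xpair_eqE; lia.
Qed.

Lemma slot_tour z : z \in outer_codes -> slot z \in tour.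
Proof.
case: z => x y; rewrite mem_outer_codes /slot /= => xy.
by repeat case: ifP => ?; rewrite mem_tour; lia.
Qed.

Lemma slot_inj : {in outer_codes &, injective slot}.
Proof.
move=> [x y] [x' y']; rewrite !mem_outer_codes /slot /= => xy xy' /eqP slotE.
apply/eqP; rewrite xpair_eqE; move: slotE.
by repeat case: ifP => ?; rewrite xpair_eqE; lia.
Qed.

Local Notation link := (detour edge slot outer_codes).

Lemma link_slot z u :
  z \in outer_codes -> link (slot z) u = edge (slot z) z && edge z u.
Proof. by apply: detour_slot; [apply: uniq_outer_codes | apply: slot_inj]. Qed.

Lemma link_inner (u v : nat * nat) : u.2 < n -> link u v = edge u v.
Proof.
move=> u_inner; apply: detour_free; apply/mapP => -[[x y]].
rewrite mem_outer_codes => xy uE; move: u_inner; rewrite uE.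
by case: (snd_slot (x, y)) => -> /= ?; lia.
Qed.

(* The guest of the slot [(a, c)], if any, contains [c]. *)
Lemma link_mixed a b c :
  a < n -> b < n -> edge (a, c) (b, c) -> link (a, c) (b, c).
Proof.
move=> lt_an lt_bn ab.
have [/mapP[z z_outer acE]|free] := boolP ((a, c) \in map slot outer_codes).
  have cE : c = (slot z).2 by rewrite -acE.
  have /andP[az _] := edge_slot z_outer lt_an.
  have /andP[_ zb] := edge_slot z_outer lt_bn.
  by rewrite acE link_slot // -acE [(a, c)]surjective_pairing /= cE az zb.
by rewrite detour_free.
Qed.

Lemma link_row a : a < n.-1 -> odd (n + a) -> link (a, n) (a, a).
Proof.
move=> lt_an odd_na.
rewrite detour_free; first by rewrite /pair_rel /fan_rel /=; lia.
apply/mapP => -[[x y]]; rewrite mem_outer_codes /slot /= => xy.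
by repeat case: ifP => ?; move/eqP; rewrite xpair_eqE; lia.
Qed.

Lemma link_bridge c :
  n <= c -> c.+1 < n + m -> link (n.-1, c) (0, c.+1).
Proof.
move=> le_nc lt_c.
have slotE : slot (c, c.+1) = (n.-1, c) by rewrite /slot /= subSnn.
rewrite -slotE link_slot ?mem_outer_codes ?slotE; last by lia.
by rewrite /pair_rel /fan_rel /=; lia.
Qed.

Definition sweep_end a := if odd (n + a) then n.-1 else n.

Lemma link_snake_end : link (0, sweep_end 0) (n.-1, n).
Proof.
rewrite /sweep_end addn0; case: ifP => odd_n.
  by rewrite link_inner /pair_rel /fan_rel /=; lia.
have slotE : slot (n, n) = (0, n) by rewrite /slot subnn /= eqxx odd_n.
rewrite -slotE link_slot ?mem_outer_codes ?slotE; last by lia.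
by rewrite /pair_rel /fan_rel /=; lia.
Qed.

Lemma link_tour_end : link (n.-1, n + m.-1) (n.-1, n.-1).
Proof.
rewrite detour_free; first by rewrite /pair_rel /fan_rel /=; lia.
apply/mapP => -[[x y]]; rewrite mem_outer_codes /slot /= => xy.
by repeat case: ifP => ?; move/eqP; rewrite xpair_eqE; lia.
Qed.

Lemma path_sweep a (u := (a.+1, sweep_end a.+1)) : a < n.-1 ->
  path link u (sweep a) /\ last u (sweep a) = (a, sweep_end a).
Proof.
move=> lt_an; rewrite {}/u /sweep /sweep_end addnS /= !if_neg /row.
have -> : n - a = (n.-1 - a).+1 by lia.
have n1E : a + (n.-1 - a) = n.-1 by lia.
case: ifP => odd_na.
  rewrite /= (last_map_iota (pair a)) n1E.
  rewrite (path_map_iota (f := pair a)) => [|b b_row].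
    rewrite link_row // link_mixed //; try lia.
    by rewrite /pair_rel /fan_rel /=; lia.
  by rewrite link_inner /pair_rel /fan_rel /=; lia.
rewrite map_cons rev_cons -map_rev rev_iotaS last_rcons rcons_path /=.
rewrite (last_map_rev_iota (pair a)).
rewrite (path_map_rev_iota (f := pair a)) => [|b b_row].
  by split=> //; rewrite n1E !link_inner /pair_rel /fan_rel /=; lia.
by rewrite link_inner /pair_rel /fan_rel /=; lia.
Qed.

Lemma path_snake k (u := (k, sweep_end k)) : k < n ->
  path link u (snake k) /\ last u (snake k) = (0, sweep_end 0).
Proof.
rewrite {}/u; elim: k => [|k IHk] lt_kn //=.
have lt_kn1 : k < n.-1 by lia.
have [path_k last_k] := path_sweep lt_kn1.
by rewrite cat_path last_cat path_k last_k; apply: IHk; apply: ltnW.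
Qed.

Lemma path_columns c l (u := (n.-1, c)) : n <= c -> c + l < n + m ->
  path link u (columns c l) /\ last u (columns c l) = (n.-1, c + l).
Proof.
rewrite {}/u /columns; elim: l c => [|l IHl] c le_nc lt_cl /=.
  by rewrite addn0.
have [|path_l last_l] := IHl c.+1 (leqW le_nc); first by lia.
have -> : [seq (a, c.+1) | a <- iota 0 n]
    = (0, c.+1) :: [seq (a, c.+1) | a <- iota 1 n.-1] by case: n n_gt1.
rewrite /= cat_path last_cat (last_map_iota (pair^~ c.+1)) add0n.
rewrite path_l last_l addSnnS andbT link_bridge //; last by lia.
split=> //; apply: (path_map_iota (f := pair^~ c.+1)) => a a_col.
by rewrite link_mixed /pair_rel /fan_rel /=; lia.
Qed.

Lemma cycle_tour : cycle link tour.
Proof.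
have sweep_end_pred : sweep_end n.-1 = n.-1.
  by rewrite /sweep_end; case: ifP; lia.
have [|path_s last_s] := @path_snake n.-1; first by lia.
have [|path_c last_c] := @path_columns n m.-1 (leqnn n); first by lia.
rewrite sweep_end_pred in path_s last_s.
rewrite /= rcons_cat cat_path /= rcons_path path_s last_s path_c last_c.
by rewrite link_snake_end link_tour_end.
Qed.

Lemma perm_fan_cycle : perm_eq fan_cycle (tour ++ outer_codes).
Proof.
rewrite (permPl (perm_insert _ _ uniq_tour)) (all_filterP _) //.
by apply/allP => z; apply: slot_tour.
Qed.

Lemma mem_fan_cycle x y : ((x, y) \in fan_cycle) = (x <= y < n + m).
Proof.
by rewrite (perm_mem perm_fan_cycle) mem_cat mem_tour mem_outer_codes; lia.
Qed.

Lemma uniq_fan_cycle : uniq fan_cycle.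
Proof.
rewrite (perm_uniq perm_fan_cycle) cat_uniq uniq_tour uniq_outer_codes andbT.
by apply/hasPn => -[x y]; rewrite mem_outer_codes /= mem_tour; lia.
Qed.

Lemma cycle_fan_cycle : cycle edge fan_cycle.
Proof. exact: cycle_insert cycle_tour. Qed.

End FanCycle.

Lemma card_sorted_pairs m : #|[set p : 'I_m * 'I_m | p.1 <= p.2]| = 'C(m.+1, 2).
Proof.
case: m => [|m]; first by rewrite bin_small //; apply: eq_card0 => -[[]].
rewrite -(card_sorted_tuples 2 m) -!sum1dep_card.
rewrite (reindex (fun p : 'I_m.+1 * 'I_m.+1 => [tuple p.1; p.2])) /=.
  by apply: eq_bigl => p; rewrite andbT.
exists (fun t => (tnth t ord0, tnth t ord_max)) => [[i j]|t] _ //.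
by apply: val_inj; rewrite /= !(tnth_nth ord0); case: t => -[|i [|j []]].
Qed.

Section Fan.
Variables m n : nat.
Local Notation M2F := (complete_double_vertex_graph (fan_graph m n)).

Definition outer_pairs : {set M2F} :=
  [set mpair (inl p.1) (inl p.2) | p : 'I_m * 'I_m].

Definition mixed_pairs : {set M2F} :=
  [set mpair (inl p.1) (inr p.2) | p : 'I_m * 'I_n].

Lemma card_mixed_pairs : #|mixed_pairs| <= m * n.
Proof. by rewrite (leq_trans (leq_imset_card _ _)) // card_prod !card_ord. Qed.

Lemma card_outer_pairs : 'C(m.+1, 2) <= #|outer_pairs|.
Proof.
pose f (p : 'I_m * 'I_m) : M2F := mpair (inl p.1) (inl p.2).
have f_inj : {in [set p : 'I_m * 'I_m | p.1 <= p.2] &, injective f}.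
  move=> [i j] [i' j']; rewrite !inE /= => ij ij' /mpair_inj[] [[iE] [jE]].
    by rewrite iE jE.
  rewrite iE jE in ij *; have -> // : i' = j'.
  by apply/val_inj/anti_leq; rewrite ij ij'.
rewrite -card_sorted_pairs -(card_in_imset f_inj).
by apply/subset_leq_card/subsetP => _ /imsetP[p _ ->]; apply: imset_f.
Qed.

Lemma adj_outer_mixed A B : A \in outer_pairs -> adj A B -> B \in mixed_pairs.
Proof.
move=> /imsetP[[i j] _ ->] /complete_double_adjP[x [y [z [AE -> yz]]]].
have mixed (i' j' : 'I_m) :
    x = inl i' -> y = inl j' -> mpair x z \in mixed_pairs.
  move=> xE yE; case: z yz => [k|a] yz; first by rewrite yE in yz.
  by rewrite xE; apply/imsetP; exists (i', a).
case/mpair_inj: AE => -[/esym iE /esym jE]; first exact: mixed iE jE.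
exact: mixed jE iE.
Qed.

Lemma hamiltonian_fan_ltn : 0 < m -> 0 < n -> hamiltonian M2F -> m.+1 < 2 * n.
Proof.
move=> m_gt0 n_gt0 ham.
pose i0 := Ordinal m_gt0; pose a0 := Ordinal n_gt0.
have outer_neq0 : outer_pairs != set0.
  apply/set0Pn; exists (mpair (inl i0) (inl i0)).
  by apply/imsetP; exists (i0, i0).
have not_covering : outer_pairs :|: mixed_pairs != setT.
  rewrite -subTset; apply/subsetPn; exists (mpair (inr a0) (inr a0)) => //.
  by rewrite inE; apply/norP; split; apply/imsetP => -[p _] /mpair_inj[] [].
have lt_outer_mixed : #|outer_pairs| < #|mixed_pairs|.
  exact: hamiltonian_card_ltn ham adj_outer_mixed outer_neq0 not_covering.
have : m * m.+1 < m * (2 * n).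
  have := mul_bin_diag m.+1 1; rewrite bin1 /= mulnCA.
  by have := card_mixed_pairs; have := card_outer_pairs; lia.
by rewrite ltn_pmul2l.
Qed.

Lemma fan_hamiltonian : 1 < n -> 0 < m -> m <= 2 * (n - 1) -> hamiltonian M2F.
Proof.
move=> n_gt1 m_gt0 le_mn.
pose i0 := Ordinal m_gt0; pose a0 := Ordinal (ltnW n_gt1).
have nm_gt1 : 1 < n + m by lia.
apply: (hamiltonian_complete_double (@fan_vertexK m n i0 a0) (fan_codeK i0 a0)
  (@fan_code_lt m n) (@adj_fan_vertex m n i0 a0) nm_gt1
  (uniq_fan_cycle n_gt1 m_gt0 le_mn) (cycle_fan_cycle n_gt1 m_gt0 le_mn)).
by case=> x y; rewrite mem_fan_cycle.
Qed.

End Fan.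

Theorem theorem1 (m n : nat) (hm : 1 <= m) (hn : 1 <= n) :
  hamiltonian (complete_double_vertex_graph (fan_graph m n)) <->
  (2 <= n /\ 1 <= m <= 2 * (n - 1)).
Proof.
split=> [/(hamiltonian_fan_ltn hm hn) bound|[n_gt1 /andP[m_gt0 le_mn]]].
  by lia.
exact: fan_hamiltonian.
Qed.
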